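(* Let $\mathcal{F} = \{f_{r} \mid r \in \mathcal{R}\}$ and $\mathcal{G} = \{g_{r} \mid r \in \mathcal{R}\}$ consist of functions mapping $\mathcal{X}$ to $[0,1]$, parameterized by the same set $\mathcal{R} \subseteq \mathbb{R}^d$. For any (finite, nonempty) set $\mathcal{S} \subseteq \mathcal{X}$, $$\widehat{\mathfrak{R}}_{\mathcal{S}}(\mathcal{F}) \leq \widehat{\mathfrak{R}}_{\mathcal{S}}(\mathcal{G}) + \frac{1}{|\mathcal{S}|} \sum_{x \in \mathcal{S}} \| f_x^* - g_x^*\|_{\infty}.$$
   Context: $\mathcal{X}$ is an abstract domain and $\mathcal{R} \subseteq \mathbb{R}^d$ is a nonempty parameter set. For $x \in \mathcal{X}$, the dual functions $f_x^*, g_x^* : \mathcal{R} \to [0,1]$ are $f_x^*(r) = f_r(x)$ and $g_x^*(r) = g_r(x)$, and $\|f_x^* - g_x^*\|_\infty = \sup_{r \in \mathcal{R}} |f_x^*(r) - g_x^*(r)|$. The empirical Rademacher complexity of $\mathcal{F}$ given $\mathcal{S} = \{x_1, \dots, x_N\} \subseteq \mathcal{X}$ is $$\widehat{\mathfrak{R}}_{\mathcal{S}}(\mathcal{F}) = \frac{1}{N}\, \mathbb{E}_{\sigma \sim \{-1,1\}^N}\left[\sup_{r \in \mathcal{R}} \sum_{i=1}^N \sigma_i f_r(x_i)\right],$$ where $\sigma_1,\dots,\sigma_N$ are independent and each equals $-1$ or $1$ with equal probability; $\widehat{\mathfrak{R}}_{\mathcal{S}}(\mathcal{G})$ is defined likewise.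 *)

(* Defs.v *)
From HB Require Import structures.
From mathcomp Require Import all_boot all_order all_algebra finmap.
From mathcomp Require Import all_classical all_reals.
Set Implicit Arguments.
Unset Strict Implicit.
Unset Printing Implicit Defensive.
Import Order.TTheory GRing.Theory Num.Theory.
Local Open Scope classical_set_scope.
Local Open Scope ring_scope.

(* A sign vector indexed by a finite type I is encoded by s : {ffun I -> bool};
   its i-th coordinate is the value (-1) ^+ s i in {-1, 1}. *)
Definition sign_of (R : realType) (b : bool) : R := (-1) ^+ b.

Definition rademacher_pmf (R : realType) (b : bool) : R := 2^-1.

(* Expectation of h under the product over I of the law rademacher_pmf,
   i.e. with independent, uniformly distributed signs. *)
Definition rademacher_expectation (R : realType) (I : finType)
    (h : {ffun I -> bool} -> R) : R :=
  \sum_(s : {ffun I -> bool}) (\prod_(i : I) rademacher_pmf R (s i)) * h s.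

(* The suprema below are real-valued; they are the usual ones as long as P is
   nonempty and the functions involved are bounded on P. *)
Definition empirical_rademacher (R : realType) (T : Type) (X : choiceType)
    (P : set T) (f : T -> X -> R) (S : {fset X}) : R :=
  (#|` S|%:R)^-1 *
  rademacher_expectation (fun s : {ffun S -> bool} =>
    sup [set \sum_(x : S) sign_of R (s x) * f r (val x) | r in P]).

Definition dual_fun (R : realType) (T X : Type) (f : T -> X -> R) (x : X) :
  T -> R := fun r => f r x.

Definition sup_norm (R : realType) (T : Type) (P : set T) (u : T -> R) : R :=
  sup [set `|u r| | r in P].

(* Main.v *)
Require Import Defs.
From HB Require Import structures.
From mathcomp Require Import all_boot all_order all_algebra finmap.
From mathcomp Require Import all_classical all_reals.
Set Implicit Arguments.
Unset Strict Implicit.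
Unset Printing Implicit Defensive.
Import Order.TTheory GRing.Theory Num.Theory.
Local Open Scope classical_set_scope.
Local Open Scope ring_scope.

(** For every fixed sign vector, [\sum_x s_x f_r(x)] exceeds [\sum_x s_x g_r(x)] by at
    most the sum over [x] of [|f_r(x) - g_r(x)|], which the sup norms of the dual functions
    bound uniformly in [r]. The suprema over [r] therefore differ by at most this
    constant, and so do their expectations over the signs. *)

(** [C] witnesses that the values are bounded above; on an unbounded set [sup] would be a default
    value rather than an upper bound. *)
Lemma le_sup_norm (R : realType) (T : Type) (P : set T) (u : T -> R) (C : R) r :
  (forall r', P r' -> `|u r'| <= C) -> P r -> `|u r| <= sup_norm P u.
Proof.
move=> uC Pr; apply: ub_le_sup; last by exists r.
by exists C => _ [r' Pr' <-]; apply: uC.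
Qed.

Lemma normr_sign_of (R : realType) b : `|sign_of R b| = 1.
Proof. by rewrite /sign_of normr_sign. Qed.

Lemma le_rademacher_expectation (R : realType) (I : finType)
    (h k : {ffun I -> bool} -> R) :
  (forall s, h s <= k s) -> rademacher_expectation h <= rademacher_expectation k.
Proof.
move=> hk; apply: ler_sum => s _; apply: ler_wpM2l => //.
by apply: prodr_ge0 => i _; rewrite invr_ge0 ler0n.
Qed.

(** Distributivity turns the sum of products into a product over [I] whose factors are all
    [2^-1 + 2^-1]. *)
Lemma sum_rademacher_pmf (R : realType) (I : finType) :
  \sum_(s : {ffun I -> bool}) \prod_(i : I) rademacher_pmf R (s i) = 1.
Proof.
rewrite -(bigA_distr_bigA (fun (_ : I) b => rademacher_pmf R b)).
rewrite big1 // => i _.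
by rewrite big_bool /= /rademacher_pmf -mulr2n -[_ *+ 2]mulr_natl divff ?pnatr_eq0.
Qed.

Lemma rademacher_expectationDr (R : realType) (I : finType)
    (h : {ffun I -> bool} -> R) (c : R) :
  rademacher_expectation (fun s => h s + c) = rademacher_expectation h + c.
Proof.
rewrite /rademacher_expectation -{2}[c]mul1r -[X in X * c](sum_rademacher_pmf R I).
by rewrite mulr_suml -big_split /=; apply: eq_bigr => s _; rewrite mulrDr.
Qed.

(** Each [u r] lies below [sup v + c], since boundedness makes [sup v] dominate every [v r];
    nonemptiness then lets this bound pass to [sup u]. *)
Lemma sup_image_leD (R : realType) (T : Type) (P : set T) (u v : T -> R) (c : R) :
  P !=set0 -> has_ubound [set v r | r in P] ->
  (forall r, P r -> u r <= v r + c) ->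
  sup [set u r | r in P] <= sup [set v r | r in P] + c.
Proof.
move=> [r0 Pr0] vub uv; apply: ge_sup; first by exists (u r0), r0.
move=> _ [r Pr <-]; apply: le_trans (uv r Pr) _.
by rewrite lerD2r; apply: ub_le_sup => //; exists r.
Qed.

Lemma ler_sum_sign_of (R : realType) (I : finType) (s : I -> bool) (u w : I -> R) :
  (forall i, `|u i| <= w i) -> \sum_i sign_of R (s i) * u i <= \sum_i w i.
Proof.
move=> uw; apply: ler_sum => i _; apply: le_trans (ler_norm _) _.
by rewrite normrM normr_sign_of mul1r.
Qed.

Theorem theorem4p3 (R : realType) (X : choiceType) (d : nat)
    (P : set 'rV[R]_d) (f g : 'rV[R]_d -> X -> R) (S : {fset X})
    (P_nonempty : P !=set0)
    (f_range : forall r, P r -> forall x, 0 <= f r x <= 1)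
    (g_range : forall r, P r -> forall x, 0 <= g r x <= 1)
    (S_nonempty : S != fset0) :
  empirical_rademacher P f S <=
    empirical_rademacher P g S +
    (#|` S|%:R)^-1 *
      \sum_(x <- S) sup_norm P (fun r => dual_fun f x r - dual_fun g x r).
Proof.
(* The sum of sup norms does not depend on the signs, so it moves inside the expectation and the
   comparison can be made sign vector by sign vector. *)
rewrite /empirical_rademacher -mulrDr -rademacher_expectationDr.
apply: ler_wpM2l; first by rewrite invr_ge0 ler0n.
apply: le_rademacher_expectation => s.
rewrite big_seq_fsetE /=; apply: sup_image_leD => //.
  (* Since [g] takes values in [0,1], the signed sums are at most the cardinality of [S]. *)
  exists (\sum_(x : S) 1) => _ [r Pr <-]; apply: ler_sum_sign_of => x.
  by have /andP[g0 g1] := g_range r Pr (val x); rewrite ger0_norm.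
move=> r Pr; rewrite -lerBlDl -sumrB.
under [X in X <= _]eq_bigr do rewrite -mulrBr.
apply: ler_sum_sign_of => x.
(* Two numbers of [0,1] differ by at most 1, whence [C := 1]. *)
apply: (le_sup_norm (u := fun r => f r (val x) - g r (val x)) (C := 1)) Pr.
move=> r' Pr'; rewrite ler_distl.
have /andP[f0 f1] := f_range r' Pr' (val x).
have /andP[g0 g1] := g_range r' Pr' (val x).
by rewrite lerBlDr (le_trans g1) ?(le_trans f1) ?lerDl ?lerDr.
Qed.
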